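(* Let $n$ be a positive integer. Any set of mutually weakly unbiased Hadamard matrices of order $n$ has size at most $2$.
   Context: A Hadamard matrix of order $n$ is an $n\times n$ $(\pm1)$-matrix $H$ with $HH^T=nI_n$. Two Hadamard matrices $H,K$ of order $n$ are weakly unbiased if, writing $a_{ij}$ for the $(i,j)$-entry of $HK^T$, one has $a_{ij}\equiv 2\pmod 4$ for all $i,j$ and $|\{|a_{ij}|: i,j\in\{1,\ldots,n\}\}|\le 2$; by convention the paper excludes unbiased pairs (those with $|a_{ij}|=\sqrt n$ for all $i,j$), so that the set of absolute values has exactly two elements. A set of Hadamard matrices is mutually weakly unbiased if every pair of two distinct members is weakly unbiased. *)

(* Defs.v *)
From mathcomp Require Import all_boot all_order all_algebra all_field.
From mathcomp Require Import boolp classical_sets functions cardinality.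

Set Implicit Arguments.
Unset Strict Implicit.
Unset Printing Implicit Defensive.

Import Order.TTheory GRing.Theory Num.Theory.

Local Open Scope classical_set_scope.
Local Open Scope card_scope.
Local Open Scope ring_scope.

Definition hadamard (n : nat) (H : 'M[int]_n) : Prop :=
  (forall i j, H i j = 1 \/ H i j = -1) /\ H *m H^T = n%:R%:M.

(* The equation is stated in [algC] because [n] need not be a square. *)
Definition unbiased (n : nat) (H K : 'M[int]_n) : Prop :=
  forall i j, `|(H *m K^T) i j|%:~R = sqrtC n%:R :> algC.

(* The last clause is the convention that unbiased pairs are excluded. *)
Definition weakly_unbiased (n : nat) (H K : 'M[int]_n) : Prop :=
  [/\ forall i j, ((H *m K^T) i j = 2 %[mod 4])%Z,
      range (fun ij : 'I_n * 'I_n => `|(H *m K^T) ij.1 ij.2|) #<= `I_2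
    & ~ unbiased H K].

Definition mutually_weakly_unbiased (n : nat) (S : set 'M[int]_n) : Prop :=
  (forall H, S H -> hadamard H) /\
  (forall H K, S H -> S K -> H <> K -> weakly_unbiased H K).

(* Main.v *)
(* For sign vectors x, y, z of length n, 4 divides n + <x,y> + <y,z> + <x,z>,
   since 1 + ab + bc + ac is 0 or 4 for signs a, b, c.  Taking one row from
   each of three mutually weakly unbiased matrices gives n = -6 = 2 mod 4, in
   particular n >= 2; taking one row of the first matrix and two (orthogonal)
   rows of the second gives n = -4 = 0 mod 4. *)
Require Import Defs.
From mathcomp Require Import all_boot all_order all_algebra all_field.
From mathcomp Require Import boolp classical_sets functions cardinality.
From mathcomp Require Import zify.

Local Open Scope classical_set_scope.
Local Open Scope card_scope.
Local Open Scope ring_scope.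

Lemma sign_rows_dvd4 (p q r n : nat) (A : 'M[int]_(p, n)) (B : 'M[int]_(q, n))
    (C : 'M[int]_(r, n)) (i : 'I_p) (j : 'I_q) (k : 'I_r) :
  (forall l, A i l = 1 \/ A i l = -1) ->
  (forall l, B j l = 1 \/ B j l = -1) ->
  (forall l, C k l = 1 \/ C k l = -1) ->
  (4 %| n%:Z + (A *m B^T)%R i j + (B *m C^T)%R j k + (A *m C^T)%R i k)%Z.
Proof.
move=> A1 B1 C1.
(* Writing n as a sum of ones merges the four terms into a single sum over the columns, so
   divisibility is checked column by column. *)
have -> : n%:Z = \sum_(l < n) 1 by rewrite GRing.sumr_const card_ord natz.
rewrite !mxE -!big_split /=; apply: GRing.rpred_sum => l _; rewrite !mxE.
by case: (A1 l) => ->; case: (B1 l) => ->; case: (C1 l) => ->.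
Qed.

Lemma not_three_sign_matrices_mod4 (n : nat) (H K L : 'M[int]_n) :
  (0 < n)%N -> hadamard H -> hadamard K -> hadamard L ->
  (forall i j, ((H *m K^T)%R i j = 2 %[mod 4])%Z) ->
  (forall i j, ((K *m L^T)%R i j = 2 %[mod 4])%Z) ->
  (forall i j, ((H *m L^T)%R i j = 2 %[mod 4])%Z) -> False.
Proof.
move=> n0 [H1 _] [K1 KK] [L1 _] HK KL HL.
pose a : 'I_n := Ordinal n0.
have n2 : (n %% 4 = 2)%N.
  have := sign_rows_dvd4 _ _ _ _ _ _ _ a a a (H1 a) (K1 a) (L1 a).
  have := HK a a; have := KL a a; have := HL a a; lia.
have n1 : (1 < n)%N by lia.
pose b : 'I_n := Ordinal n1.
(* [K] serves as both second and third matrix. As [a] and [b] are the indices 0 and 1, the middle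
   product is an off-diagonal entry of n I, leaving n + 2 + 0 + 2 = 0 mod 4. *)
have := sign_rows_dvd4 _ _ _ _ _ _ _ a a b (H1 a) (K1 a) (K1 b).
have -> : (K *m K^T) a b = 0 by rewrite KK mxE.
have := HK a a; have := HK a b; lia.
Qed.

(** Fix x in S, if there is one. Any two elements of S other than x coincide, so the truth value of
    [x = y] determines y within S and embeds S into {0, 1}. *)
Lemma card_le_II2 (T : Type) (S : set T) :
  (forall x y z, S x -> S y -> S z -> [\/ x = y, y = z | x = z]) -> S #<= `I_2.
Proof.
move=> S3; have [[x Sx]|S0] := pselect (exists x, S x); last first.
  apply/card_subP; exists set0; last exact: sub0set.
  by rewrite (_ : S = set0) ?card_eqxx // -subset0 => x Sx; case: S0; exists x.
apply/card_subP; exists ((fun y => nat_of_bool `[< x = y >]) @` S).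
  apply: inj_card_eq => y z; rewrite !inE => Sy Sz.
  case: asboolP => [<-|xy]; case: asboolP => [<-|xz] // _.
  by case: (S3 x y z).
by move=> _ [y _ <-] /=; case: `[< _ >].
Qed.

Theorem theorem6p1 (n : nat) (hn : (0 < n)%N) (S : set 'M[int]_n)
    (hS : mutually_weakly_unbiased S) :
  S #<= `I_2.
Proof.
case: hS => had wu; apply: card_le_II2 => H K L SH SK SL.
have [HK|HK] := pselect (H = K); first exact: Or31.
have [KL|KL] := pselect (K = L); first exact: Or32.
have [HL|HL] := pselect (H = L); first exact: Or33.
have [HK4 _ _] := wu _ _ SH SK HK.
have [KL4 _ _] := wu _ _ SK SL KL.
have [HL4 _ _] := wu _ _ SH SL HL.
by case: (not_three_sign_matrices_mod4 n H K L hn); auto.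
Qed.
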